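(* Let $\gamma:(a,b)\to U^\circ$ be an absolutely continuous curve. Then $L_{g_N}(\gamma)\uparrow L_g(\gamma)$ in $[0,\infty]$; that is, $L_{g_N}(\gamma)$ is nondecreasing in $N$ and converges to $L_g(\gamma)$ as $N\to\infty$.
   Context: Let $k\ge0$, let $V\subset\mathbb R^k$ be open, let $\varepsilon>0$, and let $U=[0,\varepsilon)^2\times V$ with coordinates $(x,y,z)$, $U^\circ=(0,\varepsilon)^2\times V$. Let $g_{\mathrm E}$ be the Euclidean metric and $g_0$ a smooth Riemannian metric on $U$ with $c_0g_{\mathrm E}\le g_0\le C_0g_{\mathrm E}$ for constants $0<c_0\le C_0<\infty$. Let $\alpha_j=(a_j,b_j)$, $j\ge1$, be points of a fixed compact subset of $\mathbb R_{\ge0}^2$, and let $c_j>0$ with $\sum_{j\ge1}c_j<\infty$. Put $\mu=\sum_{j\ge1}c_j\delta_{\alpha_j}$, $F(x,y)=\sum_{j=1}^\infty c_jx^{-a_j}y^{-b_j}$, $F_N(x,y)=\sum_{j=1}^Nc_jx^{-a_j}y^{-b_j}$, $g=Fg_0$ and $g_N=F_Ng_0$ on $U^\circ$. $L_g$ and $L_{g_N}$ denote lengths with respect to these metrics. *)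

(* Defs.v *)
From HB Require Import structures.
From mathcomp Require Import all_boot all_order all_algebra.
From mathcomp Require Import all_classical all_reals all_analysis.
Set Implicit Arguments.
Unset Strict Implicit.
Unset Printing Implicit Defensive.
Import Order.TTheory GRing.Theory Num.Theory.
Import numFieldNormedType.Exports.
Local Open Scope classical_set_scope.
Local Open Scope ring_scope.

Section Smoothness.
Variables (R : realType) (n : nat).
Implicit Types (W A : set 'rV[R]_n) (f : 'rV[R]_n -> R).

(* [Ck_on m W f]: f is C^m on W; meant for open W. *)
Fixpoint Ck_on (m : nat) W f : Prop :=
  {in W, continuous f} /\
  (if m is m'.+1 then
     forall i : 'I_n, (forall p, W p -> derivable f p (delta_mx 0 i)) /\
                      Ck_on m' W ('D_(delta_mx 0 i) f)
   else True).

(* On a set that need not be open (here, one with boundary and corners), smooth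
   means: near each point of A, f is the restriction of a C^oo function defined
   on an open subset of R^n. *)
Definition smooth_on A f : Prop :=
  forall p, A p -> exists W (h : 'rV[R]_n -> R),
    [/\ open W, W p, (forall m, Ck_on m W h)
      & forall q, W q -> A q -> h q = f q].

End Smoothness.

Section Metrics.
Variables (R : realType) (n : nat).

(* A field of bilinear forms on R^n, given by its matrix of coefficients in the
   standard coordinates. *)
Definition metric_field := 'rV[R]_n -> 'M[R]_n.

Definition quad (g : metric_field) (p v : 'rV[R]_n) : R :=
  (v *m g p *m v^T) 0 0.

Definition riemannian_on (A : set 'rV[R]_n) (g : metric_field) : Prop :=
  [/\ forall i j, smooth_on A (fun p => g p i j),
      forall p, A p -> (g p)^T = g p
    & forall p v, A p -> v != 0 -> 0 < quad g p v].

Definition euclidean : metric_field := fun _ => 1%:M.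

Definition scale_metric (f : 'rV[R]_n -> R) (g : metric_field) : metric_field :=
  fun p => f p *: g p.

Definition metric_le_on (A : set 'rV[R]_n) (g h : metric_field) : Prop :=
  forall p v, A p -> quad g p v <= quad h p v.

(* Only the restriction of gamma to ]a, b[ matters. The norm is the sup norm of
   R^n, which is equivalent to the Euclidean one. *)
Definition absolutely_continuous (a b : R) (gamma : R -> 'rV[R]_n) : Prop :=
  forall e : R, 0 < e -> exists2 d : R, 0 < d &
    forall (m : nat) (s t : 'I_m -> R),
      (forall i, [/\ a < s i, s i <= t i & t i < b]) ->
      (forall i j, i != j -> (t i <= s j) || (t j <= s i)) ->
      \sum_(i < m) (t i - s i) < d ->
      \sum_(i < m) `|gamma (t i) - gamma (s i)| < e.

(* An absolutely continuous gamma is differentiable almost everywhere; the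
   arbitrary values of [derive1 gamma] at other points do not affect the integral. *)
Definition length (g : metric_field) (a b : R) (gamma : R -> 'rV[R]_n) : \bar R :=
  (\int[@lebesgue_measure R]_(t in `]a, b[)
     (Num.sqrt (quad g (gamma t) (derive1 gamma t)))%:E)%E.

End Metrics.

Section Corner.
Variables (R : realType) (k : nat).
Implicit Types (V : set 'rV[R]_k) (p : 'rV[R]_(2 + k)).

Definition xcoord p : R := lsubmx p 0 0.
Definition ycoord p : R := lsubmx p 0 1.
Definition zcoord p : 'rV[R]_k := rsubmx p.

Definition corner_domain (eps : R) V : set 'rV[R]_(2 + k) :=
  [set p | [/\ 0 <= xcoord p < eps, 0 <= ycoord p < eps & V (zcoord p)]].

Definition corner_interior (eps : R) V : set 'rV[R]_(2 + k) :=
  [set p | [/\ 0 < xcoord p < eps, 0 < ycoord p < eps & V (zcoord p)]].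

End Corner.

Section Factor.
Variables (R : realType) (c : nat -> R) (alpha : nat -> R * R).

(* The sequences are indexed by j >= 1; their values at 0 are not used. *)
Definition partial_factor (N : nat) (x y : R) : R :=
  \sum_(1 <= j < N.+1) c j * x `^ (- (alpha j).1) * y `^ (- (alpha j).2).

Definition factor (x y : R) : R := limn (fun N => partial_factor N x y).

Variables (k : nat) (g0 : metric_field R (2 + k)).

Definition partial_metric (N : nat) : metric_field R (2 + k) :=
  scale_metric (fun p => partial_factor N (xcoord p) (ycoord p)) g0.

Definition conformal_metric : metric_field R (2 + k) :=
  scale_metric (fun p => factor (xcoord p) (ycoord p)) g0.

End Factor.

(* Main.v *)
(** Along the curve, the speed for F_N g_0 is sqrt(F_N) times the speed w for
    g_0, and sqrt(F_N) increases pointwise to sqrt(F), which is finite because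
    the exponents are bounded and the weights summable. So the claim is
    monotone convergence. The measurability of w, which would require an
    analysis of the derivative of an absolutely continuous curve, is avoided:
    the integral of a nonnegative function is the supremum of the integrals of
    the simple functions below it, and if h is simple with h <= s w and the
    measurable s_n increase to s, then the measurable functions h s_n / s lie
    below s_n w and increase to h. *)
Require Import Defs.
From HB Require Import structures.
From mathcomp Require Import all_boot all_order all_algebra.
From mathcomp Require Import all_classical all_reals all_analysis.
From mathcomp Require Import measurable_realfun.
Import Order.TTheory GRing.Theory Num.Theory.
Import numFieldNormedType.Exports.
Local Open Scope classical_set_scope.
Local Open Scope ring_scope.
Import HBNNSimple.

(** A simple function below the restriction of [f] to [D] is also below that of [g], so the supremum
    defining the second integral runs over a larger set. *)
Lemma le_integral_nonmeasurable d (T : measurableType d) (R : realType)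
    (mu : {measure set T -> \bar R}) (D : set T) (f g : T -> \bar R) :
  (forall x, D x -> (0 <= f x)%E) -> (forall x, D x -> (f x <= g x)%E) ->
  (\int[mu]_(x in D) f x <= \int[mu]_(x in D) g x)%E.
Proof.
move=> f0 fg; have g0 x : D x -> (0 <= g x)%E.
  by move=> Dx; apply: le_trans (fg _ Dx); exact: f0.
rewrite !ge0_integralE//; apply: ereal_sup_le => _ [h /= hf <-].
by exists h => //= x; apply: le_trans (hf x) _; exact: lee_restrict.
Qed.

Lemma cvg_integral_nonmeasurable_factor d (T : measurableType d)
    (R : realType) (mu : {measure set T -> \bar R}) (D : set T)
    (s_ : nat -> T -> R) (s w : T -> R) :
  measurable D ->
  (forall n, measurable_fun D (s_ n)) ->
  (forall n x, D x -> 0 <= s_ n x) -> (forall x, 0 <= w x) ->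
  (forall x, D x -> {homo s_ ^~ x : m n / (m <= n)%N >-> m <= n}) ->
  (forall x, D x -> s_ n x @[n --> \oo] --> s x) ->
  (\int[mu]_(x in D) (s_ n x * w x)%:E)%E @[n --> \oo]
    --> (\int[mu]_(x in D) (s x * w x)%:E)%E.
Proof.
move=> mD ms s0 w0 nds cvs.
have les n x : D x -> s_ n x <= s x.
  move=> Dx; have <- := cvg_lim (@Rhausdorff R) (cvs x Dx).
  apply: (@nondecreasing_cvgn_le _ (s_ ^~ x)); first exact: nds.
  by apply/cvg_ex; exists (s x); exact: cvs.
have sx0 x : D x -> 0 <= s x.
  by move=> Dx; apply: le_trans (les 0%N _ Dx); exact: s0.
pose I n := (\int[mu]_(x in D) (s_ n x * w x)%:E)%E.
have ndI : nondecreasing_seq I.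
  move=> m n mn; apply: le_integral_nonmeasurable => x Dx.
    by rewrite lee_fin mulr_ge0 ?s0.
  by rewrite lee_fin ler_wpM2r ?nds.
have cvI := ereal_nondecreasing_cvgn ndI.
(* The integrals increase, so they tend to their supremum; it remains to identify this supremum. *)
suff <- : ereal_sup (range I) = (\int[mu]_(x in D) (s x * w x)%:E)%E by [].
apply/eqP; rewrite eq_le; apply/andP; split.
  apply: ge_ereal_sup => _ [n _ <-]; apply: le_integral_nonmeasurable => x Dx.
    by rewrite lee_fin mulr_ge0 ?s0.
  by rewrite lee_fin ler_wpM2r ?les.
rewrite ge0_integralE; last by move=> x Dx; rewrite lee_fin mulr_ge0 ?sx0.
apply: ge_ereal_sup => _ [h /= hf <-].
(* Division by 0 gives 0, so [hn n x = 0] where [s x = 0]; there [h <= s * w] forces [h x = 0], so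
   [hn] tends to [h] at these points too. *)
pose hn n x := (h x * (s_ n x / s x))%:E.
have h0 x : 0 <= h x by exact: fun_ge0.
have hsw x : D x -> h x <= s x * w x.
  by move=> Dx; have := hf x; rewrite patchE mem_set.
have msx : measurable_fun D s by apply: measurable_fun_cvg ms cvs.
(* Off [D], [h] is squeezed between 0 and the extension by zero, hence vanishes; its integral may
   thus be taken over [D], where [h] is the limit of [hn]. *)
have -> : sintegral mu h =
    (\int[mu]_(x in D) (fun x => limn (hn ^~ x)) x)%E.
  rewrite -integralT_nnsfun integral_mkcond [RHS]integral_mkcond.
  apply: eq_integral => x _; rewrite patch_setT patchE.
  have := hf x; rewrite patchE; case: ifPn => [/set_mem Dx _|nDx]; last first.
    by rewrite lee_fin => hx0; congr EFin; apply/eqP; rewrite eq_le hx0 h0.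
  have hxE : h x = h x * (s x / s x).
    have [sx|sx] := eqVneq (s x) 0; last by rewrite divff// mulr1.
    have := hsw x Dx; rewrite sx mul0r => hx.
    by rewrite [h x](le_anti (_ : h x <= 0 <= h x)) ?hx ?h0// mul0r.
  apply/esym/cvg_lim => //; rewrite hxE.
  apply: cvg_EFin; first exact: nearW.
  apply: cvgM; first exact: cvg_cst.
  by apply: cvgM; [exact: cvs|exact: cvg_cst].
have chn : (\int[mu]_(x in D) hn n x)%E @[n --> \oo] -->
    (\int[mu]_(x in D) (fun x => limn (hn ^~ x)) x)%E.
  apply: cvg_monotone_convergence => //.
  - move=> n; apply/measurable_EFinP; apply: measurable_funM.
      exact: measurable_funTS.
    apply: measurable_funM => //.
    (* The inverse of [s] is the power -1 of [s] because [s] is nonnegative on [D]; this includes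
       the points where [s] is 0, both values being 0 there. *)
    apply: (eq_measurable_fun ((@powR R ^~ (-1)) \o s)).
      by move=> x /set_mem Dx /=; rewrite powR_inv1 ?sx0.
    exact: measurableT_comp (measurable_powR _) msx.
  - by move=> n x Dx; rewrite lee_fin mulr_ge0 ?divr_ge0 ?s0 ?sx0.
  - move=> x Dx m n mn; rewrite lee_fin ler_wpM2l//.
    by rewrite ler_wpM2r ?invr_ge0 ?sx0 ?nds.
rewrite -(cvg_lim _ chn)//; apply: lime_le.
  by apply/cvg_ex; eexists; exact: chn.
(* Multiplying [h <= s * w] by [s_ n / s] puts [hn n] below [s_ n * w], so its integral is at most
   [I n], hence at most the supremum. *)
apply: nearW => n; apply: (@le_trans _ _ (I n)); last first.
  by apply: ereal_sup_ubound; exists n.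
apply: le_integral_nonmeasurable => x Dx.
  by rewrite lee_fin mulr_ge0 ?divr_ge0 ?s0 ?sx0.
have [sx|sx] := eqVneq (s x) 0.
  by rewrite lee_fin sx invr0 !mulr0 mulr_ge0 ?s0.
have {}sx : 0 < s x by rewrite lt_def sx sx0.
rewrite lee_fin mulrCA ler_wpM2l ?s0// ler_pdivrMr// mulrC.
by rewrite hsw.
Qed.

(** Absolute continuity tested on the single interval between [t] and a nearby point, on either
    side, is continuity at [t]. *)
Lemma absolutely_continuous_continuous (R : realType) (n : nat) (a b : R)
    (gamma : R -> 'rV[R]_n) :
  absolutely_continuous a b gamma ->
  {in [set t | a < t < b], continuous gamma}.
Proof.
move=> acg t /set_mem /= tab.
apply/cvgrPdist_lt => e e0; have [d d0 acd] := acg e e0.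
have : \forall u \near t, `|t - u| < d by exact: nbhsx_ballx.
have : \forall u \near t, u \in `]a, b[ by apply: near_in_itvoo; rewrite in_itv.
apply: filterS2 => u; rewrite in_itv /= => uab utd.
have step (p q : R) : a < p -> p <= q -> q < b -> q - p < d ->
    `|gamma q - gamma p| < e.
  move=> ap pq qb pqd.
  have := acd 1%N (fun=> p) (fun=> q) (fun=> And3 ap pq qb).
  by rewrite !big_ord1; apply => // i j; rewrite !ord1 eqxx.
case/andP: uab tab => au ub /andP[at_ tb].
have [tu|ut] := leP t u.
  rewrite distrC; apply: step => //.
  by move: utd; rewrite distrC ger0_norm ?subr_ge0.
by apply: step => //; [exact: ltW|move: utd; rewrite gtr0_norm ?subr_gt0].
Qed.

Lemma quad_scale_metric (R : realType) (n : nat) (f : 'rV[R]_n -> R)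
    (g : metric_field R n) (p v : 'rV[R]_n) :
  quad (scale_metric f g) p v = f p * quad g p v.
Proof. by rewrite /quad /scale_metric -scalemxAr -scalemxAl mxE. Qed.

(** Since [x ^ (-a) = exp (-a ln x)], bounding [-a ln x] by its absolute value gives a bound uniform
    over all exponents [a] in [[0, B]], for [x] on either side of 1. *)
Lemma powRN_le_expR (R : realType) (x a B : R) :
  0 < x -> 0 <= a -> a <= B -> x `^ (- a) <= expR (B * `|ln x|).
Proof.
move=> x0 a0 aB; rewrite /powR gt_eqF// ler_expR.
apply: (@le_trans _ _ (a * `|ln x|)); last by rewrite ler_wpM2r.
by rewrite mulNr -mulrN ler_wpM2l// -normrN ler_norm.
Qed.

Section PartialFactor.
Variables (R : realType) (K : set (R * R)).
Variables (c : nat -> R) (alpha : nat -> R * R).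
Hypothesis hK : compact K.
Hypothesis hKpos : forall q : R * R, K q -> 0 <= q.1 /\ 0 <= q.2.
Hypothesis halpha : forall j, (1 <= j)%N -> K (alpha j).
Hypothesis hc : forall j, (1 <= j)%N -> 0 < c j.
Hypothesis hsum : (\sum_(1 <= j <oo) (c j)%:E < +oo)%E.

Lemma partial_factor_ge0 (N : nat) (x y : R) :
  0 <= partial_factor c alpha N x y.
Proof.
rewrite /partial_factor big_nat; apply: sumr_ge0 => j /andP[j1 _].
by rewrite !mulr_ge0 ?powR_ge0// ltW ?hc.
Qed.

Lemma partial_factor_nondecreasing (x y : R) :
  {homo (fun N => partial_factor c alpha N x y) : M N / (M <= N)%N >-> M <= N}.
Proof.
move=> M N MN; rewrite /partial_factor [leRHS](big_cat_nat (n := M.+1))//=.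
rewrite lerDl big_nat; apply: sumr_ge0 => j /andP[Mj _].
by rewrite !mulr_ge0 ?powR_ge0// ltW// hc// (leq_trans _ Mj).
Qed.

(** At a fixed point with positive coordinates, boundedness of [K] bounds all the powers by one
    constant, so the increasing partial sums stay below that constant times the sum of the
    weights. *)
Lemma partial_factor_cvg (x y : R) : 0 < x -> 0 < y ->
  partial_factor c alpha N x y @[N --> \oo] --> Defs.factor c alpha x y.
Proof.
move=> x0 y0; have [B [_ Bub]] := compact_bounded hK.
(* Boundedness of [K] provides a bound by every real above [B], whence [B + 1]; the norm of a pair
   is the maximum of the norms of its entries. *)
have Kle q : K q -> `|q.1| <= B + 1 /\ `|q.2| <= B + 1.
  have B1 : B < B + 1 by rewrite ltrDl.
  by move=> /(Bub _ B1) /=; rewrite prod_normE ge_max => /andP.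
pose S := fine (\sum_(1 <= j <oo) (c j)%:E)%E.
have c0 j : (1 <= j)%N -> true -> (0 <= (c j)%:E)%E.
  by move=> j1 _; rewrite lee_fin ltW ?hc.
have SE : (\sum_(1 <= j <oo) (c j)%:E)%E = S%:E.
  by rewrite fineK// ge0_fin_numE// nneseries_ge0.
have cS N : \sum_(1 <= j < N) c j <= S.
  by rewrite -lee_fin -SE -sumEFin; exact: nneseries_lim_ge.
apply: nondecreasing_is_cvgn; first exact: partial_factor_nondecreasing.
pose Ex := expR ((B + 1) * `|ln x|); pose Ey := expR ((B + 1) * `|ln y|).
exists (S * (Ex * Ey)) => _ [N _ <-].
apply: (@le_trans _ _ (\sum_(1 <= j < N.+1) c j * (Ex * Ey))); last first.
  by rewrite -mulr_suml ler_wpM2r// mulr_ge0 ?expR_ge0.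
rewrite /partial_factor !big_nat; apply: ler_sum => j /andP[j1 _].
have Kj := halpha j j1; have [a0 b0] := hKpos _ Kj; have [aB bB] := Kle _ Kj.
rewrite -mulrA ler_wpM2l ?(ltW (hc j j1))//; apply: ler_pM; rewrite ?powR_ge0//.
- by apply: powRN_le_expR => //; apply: le_trans (ler_norm _) aB.
- by apply: powRN_le_expR => //; apply: le_trans (ler_norm _) bB.
Qed.

Lemma measurable_partial_factor d (T : measurableType d) (D : set T) (N : nat)
    (f g : T -> R) : measurable_fun D f -> measurable_fun D g ->
  measurable_fun D (fun t => partial_factor c alpha N (f t) (g t)).
Proof.
move=> mf mg; apply: measurable_sum => j.
apply: measurable_funM; first apply: measurable_funM => //.
- exact: measurableT_comp (measurable_powR _) mf.
- exact: measurableT_comp (measurable_powR _) mg.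
Qed.

End PartialFactor.

Theorem proposition8p2 (R : realType) (k : nat) (V : set 'rV[R]_k) (hV : open V)
    (eps : R) (heps : 0 < eps)
    (g0 : metric_field R (2 + k))
    (hg0 : riemannian_on (corner_domain eps V) g0)
    (c0 C0 : R) (hc0 : 0 < c0) (hC0 : c0 <= C0)
    (hlow : metric_le_on (corner_domain eps V)
              (scale_metric (fun=> c0) (@euclidean R (2 + k))) g0)
    (hupp : metric_le_on (corner_domain eps V)
              g0 (scale_metric (fun=> C0) (@euclidean R (2 + k))))
    (K : set (R * R)) (hK : compact K)
    (hKpos : forall q : R * R, K q -> 0 <= q.1 /\ 0 <= q.2)
    (alpha : nat -> R * R) (halpha : forall j, (1 <= j)%N -> K (alpha j))
    (c : nat -> R) (hc : forall j, (1 <= j)%N -> 0 < c j)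
    (hsum : (\sum_(1 <= j <oo) (c j)%:E < +oo)%E)
    (a b : R) (hab : a < b) (gamma : R -> 'rV[R]_(2 + k))
    (hgammaU : forall t, a < t < b -> corner_interior eps V (gamma t))
    (hgamma : absolutely_continuous a b gamma) :
  (forall M N : nat, (1 <= M)%N -> (M <= N)%N ->
     (length (partial_metric c alpha g0 M) a b gamma
        <= length (partial_metric c alpha g0 N) a b gamma)%E) /\
  length (partial_metric c alpha g0 N) a b gamma @[N --> \oo]
    --> length (conformal_metric c alpha g0) a b gamma.
Proof.
pose x t := xcoord (gamma t); pose y t := ycoord (gamma t).
have xy0 t : `]a, b[%classic t -> 0 < x t /\ 0 < y t.
  by rewrite /= in_itv => /hgammaU[/andP[? _] /andP[? _] _].
pose w t := Num.sqrt (quad g0 (gamma t) (derive1 gamma t)).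
pose s_ N t := Num.sqrt (partial_factor c alpha N (x t) (y t)).
pose s t := Num.sqrt (Defs.factor c alpha (x t) (y t)).
have pf0 N t : 0 <= partial_factor c alpha N (x t) (y t).
  exact: partial_factor_ge0.
have cvpf t : `]a, b[%classic t ->
    partial_factor c alpha N (x t) (y t) @[N --> \oo] -->
    Defs.factor c alpha (x t) (y t).
  by move=> /xy0[xt yt]; exact: (partial_factor_cvg _ K).
have f0 t : `]a, b[%classic t -> 0 <= Defs.factor c alpha (x t) (y t).
  move=> tab; apply: limr_ge; first by apply/cvg_ex; eexists; exact: cvpf.
  exact: nearW.
have ndpf t := partial_factor_nondecreasing _ c alpha hc (x t) (y t).
(* The square root of a product splits once the first factor is nonnegative: this holds at every [t]
   for the partial sums, and on []a, b[] for their limit. *)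
have lengthE N : length (partial_metric c alpha g0 N) a b gamma =
    (\int[@lebesgue_measure R]_(t in `]a, b[) (s_ N t * w t)%:E)%E.
  by apply: eq_integral => t _; rewrite quad_scale_metric sqrtrM //; exact: pf0.
have -> : length (conformal_metric c alpha g0) a b gamma =
    (\int[@lebesgue_measure R]_(t in `]a, b[) (s t * w t)%:E)%E.
  apply: eq_integral => t /set_mem tab.
  by rewrite quad_scale_metric sqrtrM//; exact: f0.
have nds t : {homo s_ ^~ t : m n / (m <= n)%N >-> m <= n}.
  by move=> m n mn; rewrite ler_wsqrtr ?ndpf.
split=> [M N _ MN|].
  rewrite !lengthE; apply: le_integral_nonmeasurable => t _; rewrite lee_fin.
    by rewrite mulr_ge0 ?sqrtr_ge0.
  by rewrite ler_wpM2r ?sqrtr_ge0 ?nds.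
rewrite (funext lengthE).
(* Continuity of the curve on the open interval makes its coordinates measurable there, and with
   them the factors [s_ N]. *)
have mcoord j : measurable_fun `]a, b[%classic (fun t => gamma t 0 j).
  apply: open_continuous_measurable_fun; first exact: itv_open.
  move=> t /set_mem; rewrite /= in_itv /= => tab.
  apply: (@continuous_comp _ _ _ gamma (fun p => p 0 j)).
    by apply: (absolutely_continuous_continuous _ _ a b _ hgamma); rewrite inE.
  exact: coord_continuous.
apply: cvg_integral_nonmeasurable_factor => //.
(* The square root is treated as the power 1/2, so that measurability of real powers applies. *)
- move=> N; apply: (eq_measurable_fun ((@powR R ^~ 2^-1) \o
      fun t => partial_factor c alpha N (x t) (y t))).
    by move=> t _; rewrite /= powR12_sqrt.
  apply: measurableT_comp; first exact: measurable_powR.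
  have xE : x = fun t => gamma t 0 (lshift k 0).
    by apply/funext => t; rewrite /x /xcoord mxE.
  have yE : y = fun t => gamma t 0 (lshift k 1).
    by apply/funext => t; rewrite /y /ycoord mxE.
  by apply: measurable_partial_factor; rewrite ?xE ?yE; exact: mcoord.
- by move=> N t _; rewrite sqrtr_ge0.
- by move=> t; rewrite sqrtr_ge0.
- move=> t tab; exact: (cvg_comp _ _ (cvpf t tab) (@sqrt_continuous R _)).
Qed.
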